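(* Every $2$-dimensional Riemann-Lie algebra is abelian (as a Lie algebra).
   Context: A Riemann-Lie algebra is a finite-dimensional real Lie algebra $\mathfrak{g}$ with a positive definite symmetric bilinear form $(\ ,\ )$ and a bilinear product $(u,v)\mapsto uv$ on $\mathfrak{g}$ such that for all $u,v,w\in\mathfrak{g}$: (PR1) $uv-vu=[u,v]$; (PR2) $(uv,w)+(v,uw)=0$; (PR3) $[uv,w]+[u,wv]=0$. Conditions (PR1) and (PR2) determine the product uniquely from the bracket and the form: $2(uv,w)=([u,v],w)+([w,u],v)+([w,v],u)$. *)

(* Defs.v *)
From HB Require Import structures.
From mathcomp Require Import all_boot all_order all_algebra.
From mathcomp Require Import reals.

Set Implicit Arguments.
Unset Strict Implicit.
Unset Printing Implicit Defensive.

Import Order.TTheory GRing.Theory Num.Theory.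
Local Open Scope ring_scope.

(* A [vectType R] is finite-dimensional, and every [realType] is isomorphic to
   the field of real numbers. *)
Record lieAlgebra (R : realType) := LieAlgebra {
  lie_sort :> vectType R;
  lie : {bilinear lie_sort -> lie_sort -> lie_sort};
  liexx : forall u, lie u u = 0;
  lie_jacobi : forall u v w,
    lie u (lie v w) + lie v (lie w u) + lie w (lie u v) = 0
}.

Definition lie_abelian (R : realType) (g : lieAlgebra R) :=
  forall u v : g, lie g u v = 0.

(* [{dot g for idfun}] is the type of symmetric bilinear forms
   [f : g -> g -> R] with [0 < f u u] for all [u != 0]: a Hermitian form for the
   identity involution is symmetric bilinear. *)
Record riemannLieAlgebra (R : realType) := RiemannLieAlgebra {
  rl_lie :> lieAlgebra R;
  rl_form : {dot rl_lie for idfun};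
  rl_mul : {bilinear rl_lie -> rl_lie -> rl_lie};
  rl_PR1 : forall u v, rl_mul u v - rl_mul v u = lie rl_lie u v;
  rl_PR2 : forall u v w, rl_form (rl_mul u v) w + rl_form v (rl_mul u w) = 0;
  rl_PR3 : forall u v w,
    lie rl_lie (rl_mul u v) w + lie rl_lie u (rl_mul w v) = 0
}.

(* Main.v *)
Require Import Defs.
From mathcomp Require Import all_boot all_order all_algebra.
From mathcomp Require Import reals.

(** By Gram-Schmidt it suffices to show [e, f] = 0 when e and f are orthogonal
    and nonzero, hence a basis.  By (PR2), uv is orthogonal to v,
    so ef and ff are multiples of e, while ee and fe are multiples of f.  Then
    (PR3) at (e, f, f) and (e, e, f) reads [ef, f] = 0 and [e, fe] = 0.  If
    [e, f] were nonzero this would force ef = fe = 0, and then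
    [e, f] = ef - fe = 0 by (PR1). *)

Import Order.TTheory GRing.Theory Num.Theory.

Section PlaneGeometry.

Set Implicit Arguments.
Unset Strict Implicit.
Local Open Scope ring_scope.

Lemma dotC (R : realType) (V : vectType R) (b : {dot V for idfun}) (u v : V) :
  b u v = b v u.
Proof. by rewrite hermC /= expr0 mul1r. Qed.

(** Positivity of [b f f] is used twice: it makes [e] and [f] independent, hence a basis, and it
    forces [l = 0] when [x = k *: e + l *: f] is paired with [f]. *)
Lemma orthogonal_plane_line (R : realType) (V : vectType R)
    (b : {dot V for idfun}) (e f x : V) :
  \dim (fullv : {vspace V}) = 2%N -> e != 0 -> f != 0 -> b e f = 0 ->
  b x f = 0 -> exists k, x = k *: e.
Proof.
move=> dimV e0 f0 bef bxf.
have bff : b f f != 0 by rewrite gt_eqF ?neq0_dnorm_gt0.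
have ef_free : free [:: e; f].
  rewrite free_cons seq1_free f0 andbT span_seq1.
  apply/vlineP => -[k ek]; case/eqP: e0.
  move: bef; rewrite ek linearZl_LR /= => /eqP.
  by rewrite mulf_eq0 (negPf bff) orbF => /eqP->; rewrite scale0r.
have : basis_of fullv [:: e; f] by rewrite basisEfree ef_free subvf dimV.
move/span_basis => spanV.
have : x \in (fullv : {vspace V}) by exact: memvf.
rewrite -spanV span_cons span_seq1.
case/memv_addP => _ /vlineP[k ->] [_ /vlineP[l ->] xE].
exists k; move: bxf; rewrite xE linearDl !linearZl_LR /= bef mulr0 add0r.
by move/eqP; rewrite mulf_eq0 (negPf bff) orbF => /eqP->; rewrite scale0r addr0.
Qed.

Lemma rl_mul_orthogonal (R : realType) (g : riemannLieAlgebra R) (u v : g) :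
  rl_form g (rl_mul g u v) v = 0.
Proof.
(* By symmetry of the form, the two terms of (PR2) coincide when [w = v]. *)
have := rl_PR2 u v v; rewrite [X in _ + X]dotC => /eqP.
by rewrite -mulr2n mulrn_eq0 => /eqP.
Qed.

Lemma lie_orthogonal_eq0 (R : realType) (g : riemannLieAlgebra R) (e f : g) :
  \dim (fullv : {vspace g}) = 2%N -> e != 0 -> f != 0 ->
  rl_form g e f = 0 -> lie g e f = 0.
Proof.
move=> dimg e0 f0 bef; have bfe : rl_form g f e = 0 by rewrite dotC.
have to_e u : exists k, rl_mul g u f = k *: e.
  exact: orthogonal_plane_line dimg e0 f0 bef (rl_mul_orthogonal u _).
have to_f u : exists k, rl_mul g u e = k *: f.
  exact: orthogonal_plane_line dimg f0 e0 bfe (rl_mul_orthogonal u _).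
have [/eqP->//|w0] := boolP (lie g e f == 0).
have [a eeE] := to_f e; have [b ffE] := to_e f.
have [c efE] := to_e e; have [d feE] := to_f f.
have c0 : c = 0.
  (* Since [ff] is a multiple of [e], the term [[e, ff]] vanishes and [c [e, f] = 0] remains. *)
  have := rl_PR3 e f f.
  rewrite efE ffE linearZl_LR linearZr_LR /= liexx scaler0 addr0 => /eqP.
  by rewrite scaler_eq0 (negPf w0) orbF => /eqP.
have d0 : d = 0.
  have := rl_PR3 e e f.
  rewrite eeE feE linearZl_LR linearZr_LR /= liexx scaler0 add0r => /eqP.
  by rewrite scaler_eq0 (negPf w0) orbF => /eqP.
by rewrite -rl_PR1 efE feE c0 d0 !scale0r subr0.
Qed.

End PlaneGeometry.

Theorem lemma5p1 (R : realType) (g : riemannLieAlgebra R) :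
  \dim (fullv : {vspace g}) = 2 -> lie_abelian g.
Proof.
move=> dimg u v.
have [->|u0] := eqVneq u 0%R; first by rewrite linear0l.
(* The Gram-Schmidt coefficient: [v - k *: u] is orthogonal to [u], and its bracket with [u] is
   still [[u, v]]. *)
pose k := (rl_form g u v / rl_form g u u)%R.
have -> : lie g u v = lie g u (v - k *: u)%R.
  by rewrite linearBr linearZr_LR /= liexx scaler0 subr0.
have [->|f0] := eqVneq (v - k *: u)%R 0%R; first by rewrite linear0r.
apply: lie_orthogonal_eq0 => //.
rewrite linearBr linearZr_LR /= /k divfK ?subrr //.
by rewrite gt_eqF ?neq0_dnorm_gt0.
Qed.
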